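(* Every quaternionic unimodular matroid has the half-plane property. That is, if $E$ is a finite set, $C\subseteq\mathbb{H}^E$ is a unimodular left $\mathbb{H}$-submodule and $M=M(C)$ has set of bases $\mathcal{B}$, then the bases generating polynomial $h_M=\sum_{B\in\mathcal{B}}\prod_{i\in B}x_i\in\mathbb{R}[x_i\mid i\in E]$ is stable.
   Context: $\mathbb{H}$ denotes the skew field of quaternions, and $\mathbb{H}^E$ is regarded as a free left $\mathbb{H}$-module. For a left submodule $C\subseteq\mathbb{H}^E$, a nonzero $x\in C$ is an elementary chain of $C$ if $C$ contains no nonzero element whose support is strictly contained in the support of $x$. $C$ is unimodular if for every elementary chain $x$ of $C$ all nonzero entries of $x$ have the same norm. For unimodular $C$, the supports of the elementary chains of $C$ form the set of cocircuits of a matroid on $E$, denoted $M(C)$. A matroid of the form $M(C)$ with $C$ unimodular is called quaternionic unimodular. A polynomial $P\in\mathbb{R}[x_i\mid i\in E]$ is stable if $P(z)\neq 0$ for all $z\in\mathbb{C}^E$ with $\operatorname{Im}(z_i)>0$ for all $i\in E$. *)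

(* Defs.v *)
From HB Require Import structures.
From mathcomp Require Import all_boot all_order all_algebra.
From mathcomp Require Import ring mpoly complex reals.

Set Implicit Arguments.
Unset Strict Implicit.
Unset Printing Implicit Defensive.

Import Order.TTheory GRing.Theory Num.Theory.
Local Open Scope ring_scope.

(** * The skew field of quaternions *)

(* [Quat a b c d] is a + b i + c j + d k. *)
Record quaternion (R : Type) : Type := Quat
  { quat_re : R; quat_i : R; quat_j : R; quat_k : R }.

Definition quat_to_prod (R : Type) (x : quaternion R) : R * R * R * R :=
  (quat_re x, quat_i x, quat_j x, quat_k x).
Definition quat_of_prod (R : Type) (t : R * R * R * R) : quaternion R :=
  let: (a, b, c, d) := t in Quat a b c d.
Lemma quat_to_prodK (R : Type) :
  cancel (@quat_to_prod R) (@quat_of_prod R).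
Proof. by case. Qed.

HB.instance Definition _ (R : eqType) :=
  Equality.copy (quaternion R) (can_type (@quat_to_prodK R)).
HB.instance Definition _ (R : choiceType) :=
  Choice.copy (quaternion R) (can_type (@quat_to_prodK R)).

Section QuaternionSkewField.
Variable R : realType.
Implicit Types x y : quaternion R.

Definition quat0 : quaternion R := Quat 0 0 0 0.
Definition quat_opp x : quaternion R :=
  let: Quat a b c d := x in Quat (- a) (- b) (- c) (- d).
Definition quat_add x y : quaternion R :=
  let: Quat a b c d := x in let: Quat a' b' c' d' := y in
  Quat (a + a') (b + b') (c + c') (d + d').

Fact quat_addA : associative quat_add.
Proof. by move=> [????] [????] [????]; congr Quat; rewrite addrA. Qed.
Fact quat_addC : commutative quat_add.
Proof. by move=> [????] [????]; congr Quat; rewrite addrC. Qed.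
Fact quat_add0 : left_id quat0 quat_add.
Proof. by move=> [????]; congr Quat; rewrite add0r. Qed.
Fact quat_addN : left_inverse quat0 quat_opp quat_add.
Proof. by move=> [????]; congr Quat; rewrite addNr. Qed.

HB.instance Definition _ := GRing.isZmodule.Build (quaternion R)
  quat_addA quat_addC quat_add0 quat_addN.

Definition quat1 : quaternion R := Quat 1 0 0 0.
Definition quat_mul x y : quaternion R :=
  let: Quat a b c d := x in let: Quat a' b' c' d' := y in
  Quat (a * a' - b * b' - c * c' - d * d')
       (a * b' + b * a' + c * d' - d * c')
       (a * c' - b * d' + c * a' + d * b')
       (a * d' + b * c' - c * b' + d * a').

Fact quat_mulA : associative quat_mul.
Proof. by move=> [????] [????] [????]; congr Quat; ring. Qed.
Fact quat_mul1l : left_id quat1 quat_mul.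
Proof. by move=> [????]; congr Quat; ring. Qed.
Fact quat_mul1r : right_id quat1 quat_mul.
Proof. by move=> [????]; congr Quat; ring. Qed.
Fact quat_mulDl : left_distributive quat_mul +%R.
Proof. by move=> [????] [????] [????]; congr Quat; ring. Qed.
Fact quat_mulDr : right_distributive quat_mul +%R.
Proof. by move=> [????] [????] [????]; congr Quat; ring. Qed.
Fact quat1_neq0 : quat1 != 0.
Proof. by apply/eqP => -[] /eqP; rewrite oner_eq0. Qed.

HB.instance Definition _ := GRing.Zmodule_isNzRing.Build (quaternion R)
  quat_mulA quat_mul1l quat_mul1r quat_mulDl quat_mulDr quat1_neq0.

Definition quat_norm2 x : R :=
  let: Quat a b c d := x in a ^+ 2 + b ^+ 2 + c ^+ 2 + d ^+ 2.
Definition quat_norm x : R := Num.sqrt (quat_norm2 x).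
Definition quat_inv x : quaternion R :=
  let: Quat a b c d := x in let n := quat_norm2 x in
  Quat (a / n) (- b / n) (- c / n) (- d / n).

Lemma quat_norm2_eq0 x : (quat_norm2 x == 0) = (x == 0).
Proof.
apply/eqP/eqP => [|->]; last by rewrite /= expr0n /= !addr0.
case: x => a b c d /= /eqP.
rewrite !paddr_eq0 ?addr_ge0 ?sqr_ge0 // !sqrf_eq0.
by case/andP => /andP[/andP[/eqP -> /eqP ->] /eqP ->] /eqP ->.
Qed.

Definition quat_unit : pred (quaternion R) := fun x => x != 0.

Fact quat_mulVr : {in quat_unit, left_inverse 1 quat_inv *%R}.
Proof.
move=> [a b c d]; rewrite unfold_in -quat_norm2_eq0 /= => n0.
by congr Quat; rewrite /=; field.
Qed.
Fact quat_divrr : {in quat_unit, right_inverse 1 quat_inv *%R}.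
Proof.
move=> [a b c d]; rewrite unfold_in -quat_norm2_eq0 /= => n0.
by congr Quat; rewrite /=; field.
Qed.
Fact quat_unitP x y : y * x = 1 /\ x * y = 1 -> quat_unit x.
Proof.
case=> yx _; apply/eqP => x0.
by move/eqP: yx; rewrite x0 mulr0 eq_sym oner_eq0.
Qed.
Fact quat_inv_out : {in [predC quat_unit], quat_inv =1 id}.
Proof.
move=> x; rewrite inE /quat_unit /= negbK => /eqP ->.
by congr Quat; rewrite /= ?oppr0 mul0r.
Qed.

HB.instance Definition _ := GRing.NzRing_hasMulInverse.Build (quaternion R)
  quat_mulVr quat_divrr quat_unitP quat_inv_out.

End QuaternionSkewField.

(** * Matroids *)

Record matroid (E : finType) : Type := Matroid {
  bases : {set {set E}};
  bases_neq0 : bases != set0;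
  bases_exchange : forall A B, A \in bases -> B \in bases ->
    forall a, a \in A :\: B ->
    exists2 b, b \in B :\: A & b |: (A :\ a) \in bases }.

Section Matroid.
Variables (E : finType) (M : matroid E).
Implicit Types A B D I S T : {set E}.

Lemma bases_between A B S T : A \in bases M -> B \in bases M ->
  A \subset T -> S \subset T -> S \subset B ->
  exists2 D, D \in bases M & (S \subset D) && (D \subset T).
Proof.
move=> MA MB sAT sST; have [n] := ubnP #|B :\: T|.
elim: n B MB => // n IHn B MB; rewrite ltnS => le_n sSB.
have [sBT|/subsetPn[d dB dT]] := boolP (B \subset T).
  by exists B => //; rewrite sSB.
have dnA : d \notin A by apply: contra dT; apply: (subsetP sAT).
have dBA : d \in B :\: A by rewrite inE dnA.
have [e /setDP[eA eB] Me] := bases_exchange MB MA dBA.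
have eT := subsetP sAT _ eA.
apply: (IHn _ Me).
  apply: leq_trans le_n; apply: proper_card; apply/properP; split.
    apply/subsetP => y; rewrite !inE => /andP[yT].
    case/orP => [/eqP ye|/andP[_ ->]]; last by rewrite yT.
    by rewrite ye eT in yT.
  exists d; rewrite !inE ?dT ?dB // eqxx orbF /=.
  by apply: contra dT => /eqP ->.
apply/subsetP => y yS; rewrite !inE (subsetP sSB) // andbT.
by apply/orP; right; apply: contraNneq dT => <-; apply: (subsetP sST).
Qed.

Lemma bases_coexchange A B : A \in bases M -> B \in bases M ->
  forall a, a \in B :\: A ->
  exists2 b, b \in A :\: B & a |: (A :\ b) \in bases M.
Proof.
move=> MA MB a /setDP[aB aA].
have [||D MD /andP[sSD sDA]] :=
    @bases_between A B (a |: (A :&: B)) (a |: A) MA MB (subsetUr _ _).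
- by rewrite setUS // subsetIl.
- by rewrite subUset sub1set aB subsetIr.
have aD : a \in D by rewrite (subsetP sSD) // setU11.
have DaA y : y \in D :\: A -> y = a.
  case/setDP => yD yA; have := subsetP sDA y yD.
  by rewrite !inE (negPf yA) orbF => /eqP.
have [b bA bD] : exists2 b, b \in A & b \notin D.
  have [sAD|/subsetPn//] := boolP (A \subset D).
  have aDA : a \in D :\: A by rewrite inE aA.
  have [e /setDP[eA]] := bases_exchange MD MA aDA.
  by rewrite (subsetP sAD).
have bAD : b \in A :\: D by rewrite inE bD.
have [f /DaA -> Mb] := bases_exchange MA MD bAD.
exists b => //; rewrite inE bA andbT; apply: contra bD => bB.
by rewrite (subsetP sSD) // !inE bA bB orbT.
Qed.

Definition dual_bases : {set {set E}} := [set ~: B | B in bases M].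

Fact dual_bases_neq0 : dual_bases != set0.
Proof.
have /set0Pn[B MB] := bases_neq0 M.
by apply/set0Pn; exists (~: B); apply: imset_f.
Qed.

Fact dual_bases_exchange A B : A \in dual_bases -> B \in dual_bases ->
  forall a, a \in A :\: B ->
  exists2 b, b \in B :\: A & b |: (A :\ a) \in dual_bases.
Proof.
case/imsetP => A' MA ->{A} /imsetP[B' MB ->{B}] a aAB.
have aBA : a \in B' :\: A' by move: aAB; rewrite !inE negbK andbC.
have [b bAB Mb] := bases_coexchange MA MB aBA.
exists b; first by move: bAB; rewrite !inE negbK andbC.
apply/imsetP; exists (a |: (A' :\ b)) => //.
move: aBA bAB => /setDP[_ aA] /setDP[bA _].
apply/setP => y; rewrite !inE; have [->|yb] := eqVneq y b.
  by rewrite orbF; apply/esym; apply: contraNneq aA => <-.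
by have [->|_] := eqVneq y a.
Qed.

Definition dual : matroid E :=
  Matroid dual_bases_neq0 dual_bases_exchange.

Definition indep I : bool := [exists B in bases M, I \subset B].

Definition circuit D : bool := minset (fun A => ~~ indep A) D.

(* The variable x_i, for i in E, is the one of index [enum_rank i]. *)
Definition bases_poly (R : nzRingType) : {mpoly R[#|E|]} :=
  \sum_(B in bases M) \prod_(i in B) 'X_(enum_rank i).
End Matroid.

Definition cocircuit (E : finType) (M : matroid E) (D : {set E}) : bool :=
  circuit (dual M) D.

(** * Quaternionic unimodular matroids *)

Section Chains.
Variables (R : realType) (E : finType).

(* The regular module [^o] makes scaling act by multiplication on the left:
   [(a *: x) i = a * x i]. *)
Definition chain := {ffun E -> (quaternion R)^o}.
HB.instance Definition _ := GRing.Lmodule.on chain.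

Implicit Types (C : {pred chain}) (x y : chain).

Definition supp x : {set E} := [set i | x i != 0].

Definition elementary_chain C x : Prop :=
  [/\ x \in C, x != 0 &
      forall y, y \in C -> y != 0 -> ~~ (supp y \proper supp x)].

Definition unimodular C : Prop :=
  forall x, elementary_chain C x ->
  forall i j, x i != 0 -> x j != 0 -> quat_norm (x i) = quat_norm (x j).

(* [M = M(C)]: a matroid is determined by its cocircuits. *)
Definition is_matroid_of C (M : matroid E) : Prop :=
  forall D, cocircuit M D <-> exists2 x, elementary_chain C x & supp x = D.

Definition quaternionic_unimodular (M : matroid E) : Prop :=
  exists C, [/\ submod_closed C, unimodular C & is_matroid_of C M].
End Chains.

(** * The half-plane property *)

Definition stable (R : realType) (n : nat) (p : {mpoly R[n]}) : Prop :=
  forall z : 'I_n -> R[i], (forall i, 0 < complex.Im (z i)) ->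
  (map_mpoly (real_complex R) p).@[z] != 0.

Definition half_plane_property (R : realType) (E : finType) (M : matroid E) :
  Prop := stable (bases_poly M R).

(* Main.v *)
(* The bases sum is handled by Jacobi's formula for weighted least squares
   instead of a quaternionic Cauchy-Binet formula.  For a basis B and e in B let
   c(B,e) be the chain of C equal to 1 at e and to 0 on B - e, let z_B be the
   product of the z_b for b in B, and for an independent set S let h_S be the
   sum of the z_B over the bases B containing S.  Put
   v = sum of z_B c(B,e) over the bases B containing S + e.  Since the nonzero
   entries of c(B,e) are units a with a^-1 = conj a, exchanging B for B - e + f
   gives, for every x in C vanishing on S,
     sum_f z_f <v_f, x_f> = Re(x_e) z_e h_S.
   If h_S = 0, then v is z-orthogonal to its own real and imaginary parts, and
   Im z_f > 0 forces v = 0, whence h_(S+e) = v_e = 0.  Growing S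
   to a basis B contradicts z_B <> 0, so h_S is not 0, in particular for S
   empty. *)

Require Import Defs.
From mathcomp Require Import all_boot all_order all_algebra reals.
From mathcomp Require Import ring mpoly complex.
From mathcomp Require classical_sets.

Set Implicit Arguments.
Unset Strict Implicit.
Unset Printing Implicit Defensive.

Import Order.TTheory GRing.Theory Num.Theory.
Local Open Scope ring_scope.

(** * Cocircuits and basis exchange *)

Section MatroidBases.
Variables (E : finType) (M : matroid E).
Implicit Types (A B D : {set E}) (e f : E).

Lemma bases_antichain A B :
  A \in bases M -> B \in bases M -> A \subset B -> A = B.
Proof.
move=> MA MB sAB; apply/eqP; rewrite eqEsubset sAB /=.
apply/subsetP => e eB; apply: contraT => eA.
have eBA : e \in B :\: A by rewrite inE eA.
have [f /setDP[fA]] := bases_exchange MB MA eBA.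
by rewrite (subsetP sAB).
Qed.

Lemma indep_dual A :
  indep (dual M) A = [exists B in bases M, [disjoint A & B]].
Proof.
apply/exists_inP/exists_inP => [[_ /imsetP[B MB ->] sAB]|[B MB dAB]].
  by exists B; rewrite // disjoints_subset.
by exists (~: B); [apply: imset_f | rewrite -disjoints_subset].
Qed.

Lemma cocircuit_meets_basis D B :
  cocircuit M D -> B \in bases M -> exists2 f, f \in D & f \in B.
Proof.
move=> /minsetP[]; rewrite indep_dual => /exists_inPn nD _ MB.
by have /pred0Pn[f /andP[fD fB]] := nD B MB; exists f.
Qed.

(** By minimality of D, the set D - f misses some basis. D itself meets that basis, hence in f
    alone. *)
Lemma cocircuit_meets_basis_only D f : cocircuit M D -> f \in D ->
  exists2 B, B \in bases M & D :&: B = [set f].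
Proof.
move=> DM fD; have /minsetP[_ minD] := DM.
have : indep (dual M) (D :\ f).
  apply: contraT => nDf; have /setP/(_ f) := minD _ nDf (subD1set _ _).
  by rewrite !inE eqxx fD.
rewrite indep_dual => /exists_inP[B MB /pred0P dB]; exists B => //.
have sub g : g \in D -> g \in B -> g = f.
  by move=> gD gB; have := dB g; rewrite /= !inE gD gB !andbT => /negbFE/eqP.
have [g gD gB] := cocircuit_meets_basis DM MB.
have fB : f \in B by rewrite -(sub g).
apply/setP => h; rewrite !inE; apply/andP/eqP => [[]|->]; last by [].
exact: sub.
Qed.

(** A basis missing the complement of B - e would lie properly inside B. So this complement meets
    every basis, and a cocircuit inside it can meet B only in e. *)
Lemma fundamental_cocircuit B e : B \in bases M -> e \in B ->
  exists2 D, cocircuit M D & D :&: B = [set e].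
Proof.
move=> MB eB; have nC : ~~ indep (dual M) (~: (B :\ e)).
  rewrite indep_dual; apply/exists_inPn => A MA; apply/negP.
  rewrite disjoint_sym disjoints_subset setCK => sAB.
  have AB := bases_antichain MA MB (subset_trans sAB (subD1set _ _)).
  by have := subsetP sAB e; rewrite AB !inE eqxx eB => /(_ isT).
have [D DM sDC] := minset_exists (P := fun A => ~~ indep (dual M) A) nC.
exists D => //.
have sub g : g \in D -> g \in B -> g = e.
  by move=> /(subsetP sDC); rewrite !inE => + gB; rewrite gB andbT negbK => /eqP.
have [g gD gB] := cocircuit_meets_basis DM MB.
have eD : e \in D by rewrite -(sub g).
apply/setP => h; rewrite !inE; apply/andP/eqP => [[]|->]; last by [].
exact: sub.
Qed.

(** Exchange e against a basis A that meets D in f alone. The new basis must meet D although B - e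
    does not, so the element brought in lies in both D and A and equals f. *)
Lemma fundamental_cocircuit_exchange D B e f : cocircuit M D ->
  B \in bases M -> D :&: B = [set e] -> f \in D -> f \notin B ->
  f |: (B :\ e) \in bases M.
Proof.
move=> DM MB DB fD fB; have [A MA DA] := cocircuit_meets_basis_only DM fD.
have /setIP[eD eB] : e \in D :&: B by rewrite DB set11.
have eBA : e \in B :\: A.
  rewrite inE eB andbT; apply: contra fB => eA.
  have : e \in D :&: A by rewrite inE eD.
  by rewrite DA => /set1P <-.
have [g /setDP[gA gB] Mg] := bases_exchange MB MA eBA.
suff -> : f = g by [].
have [h hD] := cocircuit_meets_basis DM Mg.
rewrite !inE => /orP[/eqP hg|/andP[he hB]].
  have : g \in D :&: A by rewrite inE -hg hD hg.
  by rewrite DA => /set1P.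
have : h \in D :&: B by rewrite inE hD.
by rewrite DB inE (negPf he).
Qed.

End MatroidBases.

(** * The real inner product on quaternions *)

Section QuaternionDot.
Variable R : realType.
Implicit Types p q : quaternion R.

Definition quat_dot p q : R :=
  let: Quat a b c d := p in let: Quat a' b' c' d' := q in
  a * a' + b * b' + c * c' + d * d'.

Definition quat_of_real (a : R) : quaternion R := Quat a 0 0 0.

Lemma quat_dotC p q : quat_dot p q = quat_dot q p.
Proof. by case: p q => [????] [????] /=; ring. Qed.

Lemma quat_dot0l q : quat_dot 0 q = 0.
Proof. by case: q => [????] /=; ring. Qed.

Lemma quat_dot0r p : quat_dot p 0 = 0.
Proof. by rewrite quat_dotC quat_dot0l. Qed.

Lemma quat_dotDl p p' q : quat_dot (p + p') q = quat_dot p q + quat_dot p' q.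
Proof. by case: p p' q => [????] [????] [????] /=; ring. Qed.

Lemma quat_dotZl a p q :
  quat_dot (quat_of_real a * p) q = a * quat_dot p q.
Proof. by case: p q => [????] [????] /=; ring. Qed.

Lemma quat_dot1 q : quat_dot 1 q = quat_re q.
Proof. by case: q => [????] /=; ring. Qed.

Lemma quat_dotqq q : quat_dot q q = quat_norm2 q.
Proof. by case: q => [????] /=; ring. Qed.

Lemma quat_norm2_ge0 q : 0 <= quat_norm2 q.
Proof. by case: q => [????] /=; rewrite !addr_ge0 ?sqr_ge0. Qed.

(** The inverse of a quaternion of norm 1 is its conjugate, and the inner product of q with the
    conjugate of p is the real part of q p. *)
Lemma quat_dot_unitV p q :
  quat_norm p = 1 -> quat_dot p^-1 q = quat_re (q * p).
Proof.
move=> p1; have : quat_norm2 p = 1.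
  by rewrite -(sqr_sqrtr (quat_norm2_ge0 p)) -/(quat_norm p) p1 expr1n.
case: p {p1} q => [a b c d] [a' b' c' d'] /=.
rewrite /GRing.inv /= => ->; rewrite !divr1; ring.
Qed.

Lemma quat_reD p q : quat_re (p + q) = quat_re p + quat_re q.
Proof. by case: p q => [????] [????]. Qed.

End QuaternionDot.

(** * Fundamental chains of a unimodular module *)

Section ChainGroup.
Variables (R : realType) (E : finType) (M : matroid E) (C : {pred chain R E}).
Hypotheses (subC : submod_closed C) (uniC : unimodular C).
Hypothesis (MC : is_matroid_of C M).
Implicit Types (A B D S : {set E}) (e f : E) (x y : chain R E).

Lemma chain_linear a x y : x \in C -> y \in C -> a *: x + y \in C.
Proof. by case: subC => _ lin xC yC; apply: (lin a x y xC yC). Qed.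

Lemma chain0_closed : 0 \in C.
Proof. by case: subC. Qed.

Lemma chainZ a x : x \in C -> a *: x \in C.
Proof. by move=> xC; rewrite -[_ *: _]addr0 chain_linear ?chain0_closed. Qed.

Lemma chain_sum (I : finType) (P : pred I) (F : I -> chain R E) :
  (forall i, P i -> F i \in C) -> \sum_(i | P i) F i \in C.
Proof.
move=> FC; apply: (big_ind (fun x => x \in C)) => [|x y xC yC|//].
  exact: chain0_closed.
by rewrite -[x]scale1r chain_linear.
Qed.

(** A nonzero counterexample of least support would be elementary, so its support would be a
    cocircuit disjoint from B. *)
Lemma chain_vanish_basis B x : B \in bases M -> x \in C ->
  {in B, forall f, x f = 0} -> x = 0.
Proof.
move=> MB; have [n] := ubnP #|supp x|.
elim: n x => // n IHn x; rewrite ltnS => le_n xC xB.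
apply/eqP; apply: contraT => x0.
have xel : elementary_chain C x.
  split=> // y yC y0; apply/negP => ltyx; case/eqP: y0; apply: IHn => //.
    exact: leq_trans (proper_card ltyx) le_n.
  move=> f fB; apply/eqP; apply: contraT => yf.
  have : f \in supp x by apply: (subsetP (proper_sub ltyx)); rewrite inE.
  by rewrite inE xB // eqxx.
have xM : cocircuit M (supp x) by apply/MC; exists x.
have [f] := cocircuit_meets_basis xM MB.
by rewrite inE => + /xB => /eqP.
Qed.

Definition fund_chain_pred B e : pred (chain R E) :=
  [pred x | [&& x \in C, x e == 1 & [forall f in B :\ e, x f == 0]]].

(* Unique when e lies in the basis B; junk otherwise. *)
Definition fund_chain B e : chain R E :=
  classical_sets.xget 0 (fun x => fund_chain_pred B e x).

(** Take an elementary chain on a fundamental cocircuit of e and scale it on the left to have entry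
    1 at e. Unimodularity then gives every nonzero entry norm 1. *)
Lemma fund_chain_exists B e : B \in bases M -> e \in B ->
  exists x, [/\ fund_chain_pred B e x, cocircuit M (supp x) &
                forall f, x f != 0 -> quat_norm (x f) = 1].
Proof.
move=> MB eB; have [D DM DB] := fundamental_cocircuit MB eB.
have /MC[x [xC x0 xmin] Dx] := DM.
have eD : e \in D by move/setP/(_ e): DB; rewrite !inE eqxx eB andbT.
have xe : x e \is a GRing.unit by move: eD; rewrite -Dx inE.
pose y := (x e)^-1 *: x.
have yE f : y f = (x e)^-1 * x f by rewrite ffunE.
have suppy : supp y = D.
  rewrite -Dx; apply/setP => f; rewrite !inE yE mulrI_eq0 //.
  by apply: mulrI; rewrite unitrV.
have ye : y e = 1 by rewrite yE mulVr.
have yC : y \in C by apply: chainZ.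
have yel : elementary_chain C y.
  split=> // [|t tC t0]; last by rewrite suppy -Dx; apply: xmin.
  by apply/eqP => /ffunP/(_ e)/eqP; rewrite ye ffunE oner_eq0.
exists y; split; last 2 first.
- by rewrite suppy.
- move=> f yf; rewrite (uniC yel yf (j := e)) ye ?oner_eq0 //.
  by rewrite /quat_norm /= expr1n expr0n !addr0 sqrtr1.
apply/and3P; split=> //; first by rewrite ye.
apply/forall_inP => f /setD1P[fe fB]; apply: contraT => yf.
have : f \in D :&: B by rewrite -suppy !inE yf.
by rewrite DB inE (negPf fe).
Qed.

Section FundChain.
Variables (B : {set E}) (e : E).
Hypotheses (MB : B \in bases M) (eB : e \in B).

Lemma fund_chainP : fund_chain_pred B e (fund_chain B e).
Proof.
have [x [Px _ _]] := fund_chain_exists MB eB.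
exact: (@classical_sets.xgetI _ 0 (fun y => fund_chain_pred B e y) x Px).
Qed.

Lemma fund_chainC : fund_chain B e \in C.
Proof. by case/and3P: fund_chainP. Qed.

Lemma fund_chain_id : fund_chain B e e = 1.
Proof. by case/and3P: fund_chainP => _ /eqP. Qed.

Lemma fund_chain_out f : f \in B -> f != e -> fund_chain B e f = 0.
Proof.
by case/and3P: fund_chainP => _ _ /forall_inP c0 fB fe; apply/eqP/c0/setD1P.
Qed.

Lemma fund_chain_uniq x : x \in C -> x e = 1 ->
  {in B :\ e, forall f, x f = 0} -> x = fund_chain B e.
Proof.
move=> xC xe xB; apply/eqP; rewrite -subr_eq0; apply/eqP.
apply: (chain_vanish_basis MB) => [|f fB].
  by rewrite addrC -scaleN1r chain_linear // fund_chainC.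
rewrite !ffunE; have [->|fe] := eqVneq f e.
  by rewrite xe fund_chain_id subrr.
by rewrite xB ?fund_chain_out ?subrr // !inE fe.
Qed.

Lemma fund_chain_norm f :
  fund_chain B e f != 0 -> quat_norm (fund_chain B e f) = 1.
Proof.
have [x [/and3P[xC /eqP xe /forall_inP xB] _ xn]] := fund_chain_exists MB eB.
by rewrite -(fund_chain_uniq xC xe) => [/xn|g /xB/eqP].
Qed.

(** A nonzero entry puts f in the cocircuit, which allows the exchange. Conversely, a zero entry at
    f would make the chain vanish on the basis B - e + f, hence everywhere. *)
Lemma fund_chain_neq0 f : f \notin B ->
  (fund_chain B e f != 0) = (f |: (B :\ e) \in bases M).
Proof.
move=> fB; have [x [/and3P[xC /eqP xe /forall_inP xB] xM _]] :=
  fund_chain_exists MB eB.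
have -> : fund_chain B e = x.
  by apply/esym/fund_chain_uniq => // g /xB/eqP.
apply/idP/idP => [xf|Mf].
  apply: (fundamental_cocircuit_exchange xM) => //; last by rewrite inE.
  apply/setP => g; rewrite !inE; apply/andP/eqP => [[xg gB]|->].
    by apply: contraNeq xg => ge; apply: xB; rewrite !inE ge.
  by rewrite xe oner_eq0.
apply/negP => /eqP xf; suff x0 : x = 0.
  by move/eqP: xe; rewrite x0 ffunE eq_sym oner_eq0.
by apply: (chain_vanish_basis Mf) => // g /setU1P[->//|/xB/eqP].
Qed.

End FundChain.

Lemma chain_basis_expansion B x : B \in bases M -> x \in C ->
  x = \sum_(f in B) x f *: fund_chain B f.
Proof.
move=> MB xC; apply/eqP; rewrite -subr_eq0; apply/eqP.
apply: (chain_vanish_basis MB) => [|g gB].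
  rewrite addrC -scaleN1r chain_linear //; apply: chain_sum => f fB.
  by rewrite chainZ // fund_chainC.
rewrite !ffunE sum_ffunE (bigD1 g) //= big1 => [|f /andP[fB fg]].
  by rewrite ffunE fund_chain_id // [_ *: _]mulr1 addr0 subrr.
by rewrite ffunE fund_chain_out // 1?eq_sym // [_ *: _]mulr0.
Qed.

Lemma fund_chain_pivot B e f : B \in bases M -> f \in B -> e \notin B ->
  e |: (B :\ f) \in bases M ->
  fund_chain (e |: (B :\ f)) e = (fund_chain B f e)^-1 *: fund_chain B f.
Proof.
move=> MB fB eB Me; have a0 : fund_chain B f e != 0 by rewrite fund_chain_neq0.
apply/esym/fund_chain_uniq; rewrite ?setU11 ?chainZ ?fund_chainC //.
  by rewrite ffunE [_ *: _]mulVr.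
move=> g; rewrite !inE => /andP[ge]; rewrite (negPf ge) /= => /andP[gf gB].
by rewrite ffunE (fund_chain_out MB fB gB gf) [_ *: _]mulr0.
Qed.

(** Expand x in the fundamental chains of B and read off the entry at e. By the pivot, c(B - f + e,
    e) has at f the inverse of the unit c(B, f) at e, so [quat_dot_unitV] identifies the terms. *)
Lemma re_chain_exchange B e x : B \in bases M -> e \notin B -> x \in C ->
  \sum_(f in B | e |: (B :\ f) \in bases M)
     quat_dot (fund_chain (e |: (B :\ f)) e f) (x f) = quat_re (x e).
Proof.
move=> MB eB xC; rewrite [in RHS](chain_basis_expansion MB xC) sum_ffunE.
rewrite (big_morph _ (@quat_reD R) (erefl (quat_re 0))).
rewrite [RHS](bigID (fun f => e |: (B :\ f) \in bases M)) /=.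
rewrite [X in _ = _ + X]big1 ?addr0 => [|f /andP[fB]]; last first.
  by rewrite -fund_chain_neq0 // negbK ffunE => /eqP ->; rewrite [_ *: _]mulr0.
apply: eq_bigr => f /andP[fB Me]; rewrite fund_chain_pivot // !ffunE.
rewrite fund_chain_id // [_ *: 1]mulr1 quat_dot_unitV //.
by apply: fund_chain_norm; rewrite // fund_chain_neq0.
Qed.

(** * The weighted projection identity *)

Section WeightedProjection.
Variable z : E -> R[i].

Definition basis_weight B : R[i] := \prod_(i in B) z i.

Definition bases_above S : R[i] :=
  \sum_(B in bases M | S \subset B) basis_weight B.

(** Both sides are the product of the [z i] over B + f. *)
Lemma basis_weight_exchange B e f : e \in B -> f \notin B ->
  z e * basis_weight (f |: (B :\ e)) = z f * basis_weight B.
Proof.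
move=> eB fB; rewrite /basis_weight (big_setU1 f) ?inE ?(negPf fB) ?andbF //=.
by rewrite (big_setD1 e eB) /= mulrCA.
Qed.

(** The bases counted in h_S are split by whether they contain e: the terms with f = e account for
    those that do, the exchanged bases for those that do not. *)
Lemma weighted_projection S e x : x \in C -> {in S, forall f, x f = 0} ->
  e \notin S ->
  \sum_f z f * \sum_(B in bases M | e |: S \subset B)
     basis_weight B * (quat_dot (fund_chain B e f) (x f))%:C%C
  = (quat_re (x e))%:C%C * z e * bases_above S.
Proof.
move=> xC xS eS; pose d B f := (quat_dot (fund_chain B e f) (x f))%:C%C.
have eSE B : (e |: S \subset B) = (S \subset B) && (e \in B).
  by rewrite subUset sub1set andbC.
under eq_bigr do rewrite big_distrr /=; rewrite exchange_big /=.
rewrite /bases_above [in RHS](bigID (fun B => e \in B)) /= mulrDr.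
pose P B f := (f \notin B) && (f |: (B :\ e) \in bases M).
(* The entry of the fundamental chain is 1 at f = e, is 0 on B - e, and outside B is nonzero only if
   B - e + f is a basis. *)
transitivity (\sum_(B in bases M | e |: S \subset B)
   (z e * basis_weight B * (quat_re (x e))%:C%C
    + \sum_(f | P B f) z f * (basis_weight B * d B f))).
  apply: eq_bigr => B /andP[MB]; rewrite eSE => /andP[SB eB].
  rewrite (bigD1 e) //= fund_chain_id // quat_dot1 mulrA; congr (_ + _).
  rewrite big_mkcond [RHS]big_mkcond; apply: eq_bigr => f _.
  have [->|fe] := eqVneq f e; first by rewrite /P eB.
  rewrite /P; have [fB|fB] := boolP (f \in B).
    by rewrite fund_chain_out // quat_dot0l !mulr0.
  rewrite -fund_chain_neq0 //=; case: eqP => //= ->.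
  by rewrite quat_dot0l !mulr0.
rewrite big_split /=; congr (_ + _).
  rewrite big_distrr /=; apply: eq_big => B; first by rewrite eSE andbA.
  by move=> _; rewrite mulrC mulrA.
rewrite pair_big_dep /=.
(* (B, f) |-> (B - e + f, f) turns the terms with f outside B into those
   matching the bases that avoid e on the right-hand side. *)
rewrite (reindex_onto (fun p : {set E} * E => (e |: (p.1 :\ p.2), p.2))
                      (fun p : {set E} * E => (p.2 |: (p.1 :\ e), p.2)))
  /=; last first.
  move=> [B f] /= /andP[/andP[MB]]; rewrite eSE => /andP[SB eB] /andP[fB _].
  by rewrite setU1K ?setD1K // !inE negb_and fB orbT.
transitivity (\sum_(B in bases M | (S \subset B) && (e \notin B))
   \sum_(f in B | e |: (B :\ f) \in bases M)
     z e * basis_weight B * d (e |: (B :\ f)) f); last first.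
  rewrite big_distrr /=; apply: eq_big => B; first by rewrite andbA.
  move=> /and3P[MB SB eB]; rewrite -big_distrr /= -rmorph_sum /=.
  by rewrite re_chain_exchange // mulrC mulrA.
rewrite pair_big_dep /=.
rewrite big_mkcond [RHS]big_mkcond; apply: eq_bigr => -[B f] _ /=.
(* If f lies in S, then B - f + e no longer contains S and the index conditions may differ, but the
   terms vanish with [x f]. *)
have [fS|fS] := boolP (f \in S).
  by rewrite /d xS // quat_dot0r !mulr0 !if_same.
pose A := e |: (B :\ f).
have -> : ((A \in bases M) && (e |: S \subset A) && P A f)
    && ((f |: (A :\ e), f) == (B, f))
  = [&& [&& B \in bases M, S \subset B & e \notin B], f \in B
      & A \in bases M].
  rewrite eSE setU11 andbT xpair_eqE eqxx andbT /P.
  apply/idP/idP.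
    move=> /andP[/andP[/andP[MA SA] /andP[fA MB]] /eqP BE].
    have fe : f != e by apply: contraNneq fA => ->; apply: setU11.
    have eB : e \notin B by rewrite -BE !inE eqxx eq_sym (negPf fe).
    have fB : f \in B by rewrite -BE setU11.
    rewrite -{1}BE MB MA fB eB !andbT /=; apply/subsetP => g gS.
    have := subsetP SA g gS; rewrite !inE => /orP[/eqP ge|/andP[]//].
    by rewrite -ge gS in eS.
  case/and3P=> /and3P[MB SB eB] fB MA.
  have fe : f != e by apply: contraNneq eB => <-.
  have AE : A :\ e = B :\ f by rewrite setU1K // !inE (negPf eB) andbF.
  rewrite AE setD1K // MA MB eqxx !andbT !inE (negPf fe) eqxx andbT /=.
  apply/subsetP => g gS; rewrite !inE (subsetP SB) // andbT.
  by apply/orP; right; apply: contraNneq fS => <-.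
case: ifP => // /and3P[/and3P[_ _ eB] fB _].
by rewrite !mulrA basis_weight_exchange.
Qed.

(* Taken at g = Re and g = Im, the pair stands for a chain with complex
   coefficients, which commute with the quaternions. *)
Definition chain_comb (g : R[i] -> R) S e : chain R E :=
  \sum_(B in bases M | e |: S \subset B)
     quat_of_real (g (basis_weight B)) *: fund_chain B e.

Lemma chain_combC g S e : chain_comb g S e \in C.
Proof.
apply: chain_sum => B /andP[MB]; rewrite subUset sub1set => /andP[eB _].
by rewrite chainZ // fund_chainC.
Qed.

Lemma chain_combE g S e f : chain_comb g S e f =
  \sum_(B in bases M | e |: S \subset B)
     quat_of_real (g (basis_weight B)) * fund_chain B e f.
Proof. by rewrite sum_ffunE; apply: eq_bigr => B _; rewrite ffunE. Qed.

Lemma chain_comb_vanish g S e : e \notin S ->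
  {in S, forall f, chain_comb g S e f = 0}.
Proof.
move=> eS f fS; rewrite chain_combE big1 // => B /andP[MB].
rewrite subUset sub1set => /andP[eB SB].
rewrite fund_chain_out ?mulr0 ?(subsetP SB f fS) //.
by apply: contraNneq eS => <-.
Qed.

Lemma chain_comb_dot g S e f (q : quaternion R) :
  quat_dot (chain_comb g S e f) q = \sum_(B in bases M | e |: S \subset B)
     g (basis_weight B) * quat_dot (fund_chain B e f) q.
Proof.
rewrite chain_combE (big_morph (fun p => quat_dot p q) (id1 := 0) (op1 := +%R)).
- by apply: eq_bigr => B _; rewrite quat_dotZl.
- by move=> p p'; rewrite quat_dotDl.
- exact: quat_dot0l.
Qed.

(** This expresses the inner sum of [weighted_projection] through two chains of C, which can in turn
    be put in place of x there. *)
Lemma chain_comb_dotC S e f (q : quaternion R) :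
  \sum_(B in bases M | e |: S \subset B)
     basis_weight B * (quat_dot (fund_chain B e f) q)%:C%C
  = (quat_dot (chain_comb (@complex.Re R) S e f) q)%:C%C
    + 'i%C * (quat_dot (chain_comb (@complex.Im R) S e f) q)%:C%C.
Proof.
rewrite !chain_comb_dot !rmorph_sum big_distrr -big_split /=.
apply: eq_bigr => B _; rewrite !rmorphM /= [in LHS](complexE (basis_weight B)).
by rewrite mulrDl mulrA.
Qed.

(** * Nonvanishing on the upper half-plane *)

Section UpperHalfPlane.
Hypothesis z_gt0 : forall e, 0 < complex.Im (z e).

(** The imaginary part of the sum has only nonnegative terms, so each of them is zero. *)
Lemma im_weight_sum_eq0 (r : E -> R) : (forall f, 0 <= r f) ->
  \sum_f z f * (r f)%:C%C = 0 -> forall f, r f = 0.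
Proof.
move=> r_ge0 /(congr1 (@complex.Im R)) s0 f.
have : \sum_f complex.Im (z f) * r f = 0.
  rewrite -[RHS]s0 (big_morph (@complex.Im R) (id1 := 0) (op1 := +%R)) //=.
    by apply: eq_bigr => g _; case: (z g) => a b /=; rewrite mulr0 add0r.
  by case=> [a b] [a' b'].
move/eqP; rewrite psumr_eq0 => [/allP/(_ f)|g _].
  by rewrite mem_index_enum mulf_eq0 gt_eqF //= => /(_ isT)/eqP.
by rewrite mulr_ge0 // ltW.
Qed.

Lemma basis_weight_neq0 B : basis_weight B != 0.
Proof.
apply/prodf_neq0 => e _; apply: contraTneq (z_gt0 e) => ->.
by rewrite /= ltxx.
Qed.

Lemma bases_above_step S e : e \notin S ->
  bases_above S = 0 -> bases_above (e |: S) = 0.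
Proof.
move=> eS hS; pose u := chain_comb (@complex.Re R) S e.
pose w := chain_comb (@complex.Im R) S e.
have orth x : x \in C -> {in S, forall f, x f = 0} ->
    \sum_f z f * ((quat_dot (u f) (x f))%:C%C
                  + 'i%C * (quat_dot (w f) (x f))%:C%C) = 0.
  move=> xC xS; have := weighted_projection xC xS eS; rewrite hS mulr0 => s0.
  by rewrite -[RHS]s0; apply: eq_bigr => f _; rewrite chain_comb_dotC.
have uS := chain_comb_vanish (@complex.Re R) eS.
have wS := chain_comb_vanish (@complex.Im R) eS.
have r0 : forall f, quat_norm2 (u f) + quat_norm2 (w f) = 0.
  apply: im_weight_sum_eq0 => [f|]; first by rewrite addr_ge0 ?quat_norm2_ge0.
  have ou := orth u (chain_combC _ _ _) uS.
  have ow := orth w (chain_combC _ _ _) wS.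
  (* Subtracting i times the relation for w from the one for u cancels the mixed products and leaves
     the squared norms. *)
  transitivity (0 - 'i%C * 0 : R[i]); last by rewrite mulr0 subr0.
  rewrite -[X in X - _]ou -[X in _ - _ * X]ow big_distrr /= -sumrB.
  apply: eq_bigr => f _; rewrite !quat_dotqq (quat_dotC (w f)).
  have i2 : 'i%C * 'i%C = -1 :> R[i] by rewrite -expr2 sqr_i.
  rewrite rmorphD /= mulrCA -mulrBr; congr (_ * _).
  by rewrite mulrDr mulrA i2 mulN1r; ring.
have /eqP := r0 e; rewrite paddr_eq0 ?quat_norm2_ge0 // !quat_norm2_eq0.
case/andP=> /eqP ue /eqP we.
(* Every fundamental chain in the sum is 1 at e, so pairing with 1 there returns the sum of the
   weights, [bases_above (e |: S)]. *)
have := chain_comb_dotC S e e 1; rewrite -/u -/w ue we !quat_dot0l.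
rewrite mulr0 addr0 => h0; rewrite -[RHS]h0; apply: eq_bigr => B.
case/andP=> MB; rewrite subUset sub1set => /andP[eB _].
by rewrite fund_chain_id // quat_dot1 mulr1.
Qed.

(** S grows inside B by [bases_above_step] until S = B, where the sum has the single term z_B
    because no other basis contains B. *)
Lemma bases_above_neq0 S B : B \in bases M -> S \subset B ->
  bases_above S != 0.
Proof.
move=> MB; have [n] := ubnP #|B :\: S|.
elim: n S => // n IHn S; rewrite ltnS => le_n SB.
have [BS|/subsetPn[e eB eS]] := boolP (B \subset S).
  have -> : S = B by apply/eqP; rewrite eqEsubset SB.
  rewrite /bases_above (big_pred1 B) ?basis_weight_neq0 // => A /=.
  apply/andP/eqP => [[MA BA]|->//].
  by apply/esym; apply: (bases_antichain MB MA BA).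
have : bases_above (e |: S) != 0.
  apply: IHn; last by rewrite subUset sub1set eB.
  apply: leq_trans le_n; apply/proper_card/properP; split.
    by rewrite setDS // subsetUr.
  by exists e; rewrite !inE ?eB ?eS // eqxx.
by apply: contraNneq => /(bases_above_step eS) ->.
Qed.

End UpperHalfPlane.

End WeightedProjection.

End ChainGroup.

Theorem theorem5p8 (R : realType) (E : finType) (M : matroid E) :
  quaternionic_unimodular R M -> half_plane_property R M.
Proof.
case=> C [subC uniC MC] z z_gt0.
have [B MB] := set0Pn _ (bases_neq0 M).
have z_gt0' (e : E) : 0 < complex.Im (z (enum_rank e)) by [].
have := bases_above_neq0 subC uniC MC z_gt0' MB (sub0set B).
(* For empty S the sum runs over all bases and is the value of the bases polynomial at z. *)
congr (_ != 0); rewrite /bases_above /bases_poly.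
rewrite (rmorph_sum (map_mpoly _)) /= rmorph_sum /=.
apply: eq_big => A; first by rewrite sub0set andbT.
move=> _; rewrite (rmorph_prod (map_mpoly _)) /= rmorph_prod /=.
apply: eq_bigr => e _.
by rewrite map_mpolyX mevalXU.
Qed.
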